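(* Let $n\ge 1$, $X=[0,2^n)\times[0,2^n)$ (pairs of integers $x=(k,l)$), $N=|X|=2^{2n}$, and let $f:X\to G$, $f(k,l)=[k]P+[l]Q$, where $P,Q$ are points of an elliptic curve group $G=E(\mathbb{F}_p)$. Let $\omega$ be a random variable (the random masks), and for each value of $\omega$ let $\tilde f_\omega:X\to Y$ and $s_\omega:X\to\{-1,1\}$ be functions, where $Y\supseteq G$ is the finite set labelling an orthonormal basis $\{|y\rangle\}$ of the output register. Put $$B_\omega=\{x\in X:\ \tilde f_\omega(x)\neq f(x)\ \text{ or }\ s_\omega(x)=-1\},$$ $$|\Psi\rangle=\frac1{\sqrt N}\sum_{x\in X}|x\rangle|f(x)\rangle,\qquad |\tilde\Psi_\omega\rangle=\frac1{\sqrt N}\sum_{x\in X}s_\omega(x)|x\rangle|\tilde f_\omega(x)\rangle .$$ Let $S$ be a set of computational-basis labels of the input register (the outcomes on which postprocessing succeeds), let $$M=\Big(\mathrm{QFT}\,\sum_{y\in S}|y\rangle\langle y|\,\mathrm{QFT}^\dagger\Big)\otimes \mathbb{1},$$ and let $P_{\mathrm{id}}=\langle\Psi|M|\Psi\rangle$ and $\tilde P=\mathbb{E}_\omega\big[\langle\tilde\Psi_\omega|M|\tilde\Psi_\omega\rangle\big]$. Suppose $p_f\ge 0$ satisfies $\Pr_\omega[x\in B_\omega]\le p_f$ for every $x\in X$, and let $P_0\ge 0$ satisfy $P_0\le P_{\mathrm{id}}$. Then $$\tilde P\ \ge\ \big(\max\{0,\ \sqrt{P_0}-2p_f\}\big)^2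 .$$
   Context: This concerns Shor's algorithm for the elliptic curve discrete logarithm problem run with an approximate, randomly masked double-scalar multiplication. $P_{\mathrm{id}}$ is the success probability with an exact oracle, and $\tilde P$ is the expected success probability, over the random masks $\omega$, with the approximate oracle. $\mathrm{QFT}$ is the unitary quantum Fourier transform on the input register (the tensor product of two $2^n$-dimensional QFTs on the registers of $k$ and $l$), and $\mathbb 1$ is the identity on the output register. The known translation caused by the masks (adding a fixed curve point depending only on $\omega$, $P$, $Q$) is taken to have been removed from the output register, so that for $x\notin B_\omega$ one has $\tilde f_\omega(x)=f(x)$ and $s_\omega(x)=1$. The sign $s_\omega(x)$ models residual $(-1)$-phase errors. $\omega$ may be taken to range over a finite probability space. *)

(* Defs.v *)
From HB Require Import structures.
From mathcomp Require Import all_boot all_order all_algebra.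
From mathcomp Require Import ring complex mxtens.
From mathcomp Require Import reals trigo.

Set Implicit Arguments.
Unset Strict Implicit.
Unset Printing Implicit Defensive.

Import Order.TTheory GRing.Theory Num.Theory.
Local Open Scope ring_scope.
Local Open Scope complex_scope.

Section EllipticCurve.

Variable F : fieldType.

(* General Weierstrass equations
     y^2 + a1 x y + a3 y = x^3 + a2 x^2 + a4 x + a6
   rather than short ones, so that characteristics 2 and 3 are covered. *)
Definition ec_disc (a1 a2 a3 a4 a6 : F) : F :=
  let b2 := a1 ^+ 2 + 4 * a2 in
  let b4 := 2 * a4 + a1 * a3 in
  let b6 := a3 ^+ 2 + 4 * a6 in
  let b8 := a1 ^+ 2 * a6 + 4 * a2 * a6 - a1 * a3 * a4 + a2 * a3 ^+ 2 - a4 ^+ 2 in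
  - b2 ^+ 2 * b8 - 8 * b4 ^+ 3 - 27 * b6 ^+ 2 + 9 * b2 * b4 * b6.

Record elliptic_curve := EllipticCurve {
  ec_a1 : F; ec_a2 : F; ec_a3 : F; ec_a4 : F; ec_a6 : F;
  ec_smooth : ec_disc ec_a1 ec_a2 ec_a3 ec_a4 ec_a6 != 0 }.

Variable E : elliptic_curve.
Local Notation a1 := (ec_a1 E).
Local Notation a2 := (ec_a2 E).
Local Notation a3 := (ec_a3 E).
Local Notation a4 := (ec_a4 E).
Local Notation a6 := (ec_a6 E).

(* [None] is the point at infinity. *)
Definition on_curve (A : option (F * F)) : bool :=
  if A is Some (x, y)
  then y ^+ 2 + a1 * x * y + a3 * y == x ^+ 3 + a2 * x ^+ 2 + a4 * x + a6
  else true.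

(* Chord or tangent slope; the tangent formula (equal abscissae) is only used
   when the two points coincide and the tangent is not vertical. *)
Definition ec_slope (x1 y1 x2 y2 : F) : F :=
  if x1 == x2
  then (3 * x1 ^+ 2 + 2 * a2 * x1 + a4 - a1 * y1) / (2 * y1 + a1 * x1 + a3)
  else (y2 - y1) / (x2 - x1).

(* The third point of the line, (x3, l (x3 - x1) + y1), is sent to its negative
   by (x, y) -> (x, - y - a1 x - a3). *)
Definition ec_add_raw (A B : option (F * F)) : option (F * F) :=
  match A, B with
  | None, _ => B
  | _, None => A
  | Some (x1, y1), Some (x2, y2) =>
      if (x1 == x2) && (y1 + y2 + a1 * x2 + a3 == 0) then None else
      let l := ec_slope x1 y1 x2 y2 in
      let x3 := l ^+ 2 + a1 * l - a2 - x1 - x2 in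
      Some (x3, - (l * (x3 - x1) + y1) - a1 * x3 - a3)
  end.

Lemma ec_add_subproof (A B : option (F * F)) :
  on_curve A -> on_curve B -> on_curve (ec_add_raw A B).
Proof.
case: A => [[x1 y1]|//]; case: B => [[x2 y2]|//].
rewrite /ec_add_raw; case: ifP => // ncond /eqP e1 /eqP e2.
set l := ec_slope x1 y1 x2 y2.
have q0 : l * (l * (x2 - x1) + 2 * y1) + a1 * (y1 + l * x2) + a3 * l
          - (x2 ^+ 2 + x2 * x1 + x1 ^+ 2) - a2 * (x2 + x1) - a4 = 0.
  rewrite /l /ec_slope; case: eqP => [ex|/eqP nx].
    subst x2; move: ncond; rewrite eqxx /= => /negbT nz.
    have ey : y1 = y2.
      apply/eqP; rewrite -subr_eq0.
      have : (y1 - y2) * (y1 + y2 + a1 * x1 + a3) = 0.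
        have -> : (y1 - y2) * (y1 + y2 + a1 * x1 + a3) =
          (y1 ^+ 2 + a1 * x1 * y1 + a3 * y1)
          - (y2 ^+ 2 + a1 * x1 * y2 + a3 * y2) by ring.
        by rewrite e1 e2 subrr.
      by move/eqP; rewrite mulf_eq0 (negbTE nz) orbF.
    subst y2.
    have nz' : 2 * y1 + a1 * x1 + a3 != 0.
      by have <- : y1 + y1 + a1 * x1 + a3 = 2 * y1 + a1 * x1 + a3 by ring.
    by field.
  have nd : x2 - x1 != 0 by rewrite subr_eq0 eq_sym.
  set d := x2 - x1 in nd *; set m := _ / d.
  have md : m * d = y2 - y1 by rewrite /m divfK.
  apply: (mulfI nd); rewrite mulr0.
  have -> : d * (m * (m * d + 2 * y1) + a1 * (y1 + m * x2) + a3 * m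
        - (x2 ^+ 2 + x2 * x1 + x1 ^+ 2) - a2 * (x2 + x1) - a4) =
      (m * d) * (m * d + 2 * y1) + a1 * (d * y1 + (m * d) * x2) + a3 * (m * d)
        - d * ((x2 ^+ 2 + x2 * x1 + x1 ^+ 2) + a2 * (x2 + x1) + a4) by ring.
  rewrite md /d.
  transitivity ((y2 ^+ 2 + a1 * x2 * y2 + a3 * y2)
     - (x2 ^+ 3 + a2 * x2 ^+ 2 + a4 * x2 + a6)
     - ((y1 ^+ 2 + a1 * x1 * y1 + a3 * y1)
     - (x1 ^+ 3 + a2 * x1 ^+ 2 + a4 * x1 + a6))); first by ring.
  by rewrite e1 e2 !subrr.
rewrite /on_curve /=; apply/eqP/subr0_eq.
set x3 := l ^+ 2 + _ - _ - _ - _.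
transitivity ((y1 ^+ 2 + a1 * x1 * y1 + a3 * y1)
     - (x1 ^+ 3 + a2 * x1 ^+ 2 + a4 * x1 + a6)
     + (x3 - x1) * (l * (l * (x2 - x1) + 2 * y1) + a1 * (y1 + l * x2) + a3 * l
          - (x2 ^+ 2 + x2 * x1 + x1 ^+ 2) - a2 * (x2 + x1) - a4)).
  by rewrite /x3; ring.
by rewrite q0 mulr0 addr0 e1 subrr.
Qed.

Definition ec_point : Type := {A : option (F * F) | on_curve A}.

Definition ec_zero : ec_point := exist _ None isT.

Definition ec_add (A B : ec_point) : ec_point :=
  exist _ (ec_add_raw (sval A) (sval B)) (ec_add_subproof (svalP A) (svalP B)).

Definition ec_mul (k : nat) (A : ec_point) : ec_point := iter k (ec_add A) ec_zero.

End EllipticCurve.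

Definition double_mul (F : fieldType) (E : elliptic_curve F) (n : nat)
    (P Q : ec_point E) (x : 'I_(2 ^ n) * 'I_(2 ^ n)) : ec_point E :=
  ec_add (ec_mul x.1 P) (ec_mul x.2 Q).

Section Registers.

Variable R : realType.
Local Notation C := R[i].

Definition adjmx (m n : nat) (A : 'M[C]_(m, n)) : 'M[C]_(n, m) :=
  map_mx Num.conj A^T.

(* <u|A|v>, complex-valued; in the partial order of [R[i]], [a <= b] with [a] real
   forces [b] to be real. *)
Definition bracket (m : nat) (u : 'cV[C]_m) (A : 'M[C]_m) (v : 'cV[C]_m) : C :=
  (adjmx u *m A *m v) 0 0.

Variable n : nat.
Local Notation X := ('I_(2 ^ n) * 'I_(2 ^ n))%type.

Definition ket_in (x : X) : 'cV[C]_(2 ^ n * 2 ^ n) :=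
  delta_mx x.1 (0 : 'I_1) *t delta_mx x.2 (0 : 'I_1).

(* |k> is sent to (2^n)^(-1/2) sum_j exp(2 pi i j k / 2^n) |j>. *)
Definition qft1 : 'M[C]_(2 ^ n) :=
  \matrix_(j, k) (let t : R := 2 * pi * (j * k)%:R / (2 ^ n)%:R in
                  (Num.sqrt (2 ^ n)%:R)^-1%:C * (cos t +i* sin t)).

Definition qft : 'M[C]_(2 ^ n * 2 ^ n) := qft1 *t qft1.

Variable Y : finType.

Definition ket_out (y : Y) : 'cV[C]_#|Y| := delta_mx (enum_rank y) 0.

Definition ket (x : X) (y : Y) : 'cV[C]_(2 ^ n * 2 ^ n * #|Y|) :=
  ket_in x *t ket_out y.

Definition oracle_state (g : X -> Y) : 'cV[C]_(2 ^ n * 2 ^ n * #|Y|) :=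
  (Num.sqrt (#|{: X}|%:R : R))^-1%:C *: \sum_(x : X) ket x (g x).

Definition signed_oracle_state (s : X -> int) (g : X -> Y) :
    'cV[C]_(2 ^ n * 2 ^ n * #|Y|) :=
  (Num.sqrt (#|{: X}|%:R : R))^-1%:C *: \sum_(x : X) (s x)%:~R *: ket x (g x).

Definition success_op (S : {set X}) : 'M[C]_(2 ^ n * 2 ^ n * #|Y|) :=
  (qft *m (\sum_(y in S) ket_in y *m adjmx (ket_in y)) *m adjmx qft) *t 1%:M.

Definition bad_set (s : X -> int) (f g : X -> Y) : {set X} :=
  [set x | (g x != f x) || (s x == -1)].

End Registers.

(* Main.v *)
Require Import Defs.
From mathcomp Require Import all_boot all_order all_algebra.
From mathcomp Require Import complex mxtens reals.
From mathcomp Require Import trigo sesquilinear spectral ring lra.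

Set Implicit Arguments.
Unset Strict Implicit.
Unset Printing Implicit Defensive.

Import Order.TTheory GRing.Theory Num.Theory.
Local Open Scope ring_scope.
Local Open Scope complex_scope.

(** Since the QFT is unitary, [M] is an orthogonal projection, so that
    [<v|M|v> = |M v|^2] and [|M v| <= |v|].  Averaging over the masks before taking
    norms, the [x]-block of [Psi - E Psi_w] is [N^(-1/2)] times a mean of errors
    of norm at most 2 supported on the event [x \in B_w], hence of norm at most
    [2 pf]; the blocks are orthogonal, so [|Psi - E Psi_w| <= 2 pf].  The triangle
    inequality bounds [|M (E Psi_w)|] from below by [sqrt P0 - 2 pf], and Jensen's
    inequality for the squared norm moves the expectation outside. *)

Section MaskedShor.

Variable R : realType.
Local Notation C := R[i].

(** * Adjoints and Kronecker products of complex matrices *)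

Lemma adjmxE m n (A : 'M[C]_(m, n)) i j : adjmx A i j = (A j i)^*%R.
Proof. by rewrite !mxE. Qed.

Lemma adjmxM m n p (A : 'M[C]_(m, n)) (B : 'M[C]_(n, p)) :
  adjmx (A *m B) = adjmx B *m adjmx A.
Proof. by rewrite /adjmx trmx_mul map_mxM. Qed.

Lemma adjmxK m n (A : 'M[C]_(m, n)) : adjmx (adjmx A) = A.
Proof. by apply/matrixP=> i j; rewrite !adjmxE conjCK. Qed.

Lemma adjmx1 n : adjmx (1%:M : 'M[C]_n) = 1%:M.
Proof. by rewrite /adjmx trmx1 map_mx1. Qed.

Lemma adjmx_sum m n (I : finType) (P : pred I) (F : I -> 'M[C]_(m, n)) :
  adjmx (\sum_(i | P i) F i) = \sum_(i | P i) adjmx (F i).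
Proof. by rewrite /adjmx !raddf_sum. Qed.

Lemma adjmx_tens m n p q (A : 'M[C]_(m, n)) (B : 'M[C]_(p, q)) :
  adjmx (A *t B) = adjmx A *t adjmx B.
Proof. by rewrite /adjmx trmx_tens map_mxT. Qed.

Lemma tensmx11 m n : (1%:M : 'M[C]_m) *t (1%:M : 'M[C]_n) = 1%:M.
Proof.
apply/matrixP=> i j.
case: (mxtens_indexP i) => i0 i1; case: (mxtens_indexP j) => j0 j1.
rewrite tensmxE !mxE -natrM mulnb (can_eq (@mxtens_indexK m n)).
by rewrite xpair_eqE.
Qed.

(** Inner products of product vectors factor. The type ascriptions identify the width [1 * 1] of a
    tensor of columns with [1]. *)
Lemma adjmx_tens_mul m p (u u' : 'cV[C]_m) (v v' : 'cV[C]_p) :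
  adjmx (u *t v : 'cV_(m * p)) *m (u' *t v' : 'cV_(m * p)) =
  ((adjmx u *m u') 0 0 * (adjmx v *m v') 0 0)%:M.
Proof.
have -> : adjmx (u *t v : 'cV_(m * p)) = adjmx u *t adjmx v := adjmx_tens u v.
apply/matrixP=> i j; rewrite !ord1 [RHS]mxE mulr1n.
have -> : (adjmx u *t adjmx v : 'rV_(m * p)) *m (u' *t v' : 'cV_(m * p)) =
  (adjmx u *m u') *t (adjmx v *m v') :=
  tensmx_mul (adjmx u) (adjmx v) u' v'.
by rewrite mxE !ord1.
Qed.

(** The form [dotmx] acts on rows and conjugates its second argument, hence the transposes and the
    swap. *)
Lemma adjmx_mul_dot m (u v : 'cV[C]_m) : (adjmx u *m v) 0 0 = dotmx v^T u^T.
Proof.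
by rewrite dotmxE !mxE; apply: eq_bigr => i _; rewrite !mxE mulrC.
Qed.

(** * The Euclidean norm and orthogonal projections *)

(** Real-valued, so that estimates take place in the total order of [R]; the root is a nonnegative
    real, so its real part loses nothing. *)
Definition vnorm m (v : 'cV[C]_m) : R := complex.Re (sqrtC (dotmx v^T v^T)).

Lemma vnormE m (v : 'cV[C]_m) : (vnorm v)%:C = sqrtC (dotmx v^T v^T).
Proof. by rewrite RRe_real// ger0_real// sqrtC_ge0 dnorm_ge0. Qed.

Lemma vnorm_ge0 m (v : 'cV[C]_m) : 0 <= vnorm v.
Proof. by rewrite -ler0c vnormE sqrtC_ge0 dnorm_ge0. Qed.

Lemma sqr_vnorm m (v : 'cV[C]_m) : (vnorm v ^+ 2)%:C = (adjmx v *m v) 0 0.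
Proof. by rewrite rmorphXn /= vnormE sqrtCK adjmx_mul_dot. Qed.

Lemma vnormD m (u v : 'cV[C]_m) : vnorm (u + v) <= vnorm u + vnorm v.
Proof.
rewrite -lecR rmorphD /= !vnormE linearD /=.
exact: (triangle_lerif (@dotmx C m) u^T v^T).1.
Qed.

Lemma vnormZ m (a : R) (v : 'cV[C]_m) : vnorm (a%:C *: v) = `|a| * vnorm v.
Proof.
apply: (@pexpIrn _ 2) => //; rewrite ?nnegrE ?mulr_ge0 ?vnorm_ge0 //.
apply: (@complexI R); rewrite exprMn sqr_vnorm rmorphM /= sqr_vnorm.
rewrite !adjmx_mul_dot linearZ /= dnormZ normc_def /= expr0n addr0 sqrtr_sqr.
by rewrite -rmorphXn.
Qed.

Lemma vnorm0 m : vnorm (0 : 'cV[C]_m) = 0.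
Proof. by rewrite -(scale0r 0) (vnormZ 0) normr0 mul0r. Qed.

Lemma vnorm_sum m (I : finType) (P : pred I) (F : I -> 'cV[C]_m) :
  vnorm (\sum_(i | P i) F i) <= \sum_(i | P i) vnorm (F i).
Proof.
elim/big_rec2: _ => [|i x y _ IH]; first by rewrite vnorm0.
by apply: le_trans (vnormD _ _) _; rewrite lerD2l.
Qed.

Lemma bracket_proj m (A : 'M[C]_m) (v : 'cV[C]_m) :
  adjmx A = A -> A *m A = A -> bracket v A v = (vnorm (A *m v) ^+ 2)%:C.
Proof.
by move=> hA pA; rewrite sqr_vnorm adjmxM hA mulmxA -(mulmxA _ A A) pA.
Qed.

(** Pythagoras: [1 - A] is again an orthogonal projection, and [|v|^2 - |A v|^2 = |(1 - A) v|^2]. *)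
Lemma vnorm_proj m (A : 'M[C]_m) (v : 'cV[C]_m) :
  adjmx A = A -> A *m A = A -> vnorm (A *m v) <= vnorm v.
Proof.
move=> hA pA.
have hB : adjmx (1%:M - A) = 1%:M - A.
  by rewrite /adjmx linearB map_mxB -/(adjmx A) hA -/(adjmx _) adjmx1.
have pB : (1%:M - A) *m (1%:M - A) = 1%:M - A.
  by rewrite mulmxBl mul1mx mulmxBr mulmx1 pA subrr subr0.
rewrite -(@ler_pXn2r _ 2) ?nnegrE ?vnorm_ge0 // -subr_ge0.
suff -> : vnorm v ^+ 2 - vnorm (A *m v) ^+ 2 = vnorm ((1%:M - A) *m v) ^+ 2.
  exact: sqr_ge0.
apply: (@complexI R); rewrite rmorphB /= -!bracket_proj // sqr_vnorm /bracket.
by rewrite mulmxBr mulmxBl mulmx1 [RHS]mxE [X in _ = _ + X]mxE.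
Qed.

(** The norm of the mean is at most the mean [a] of the norms, and nonnegativity of the variance of
    the norms gives [a^2 <= E |v|^2]. *)
Lemma vnorm_jensen m (I : finType) (mu : I -> R) (v : I -> 'cV[C]_m) :
  (forall i, 0 <= mu i) -> \sum_i mu i = 1 ->
  vnorm (\sum_i (mu i)%:C *: v i) ^+ 2 <= \sum_i mu i * vnorm (v i) ^+ 2.
Proof.
move=> mu0 mu1; set a := \sum_i mu i * vnorm (v i).
have le_a : vnorm (\sum_i (mu i)%:C *: v i) <= a.
  apply: le_trans (vnorm_sum _ _) _; apply: ler_sum => i _.
  by rewrite vnormZ ger0_norm.
have : 0 <= \sum_i mu i * (vnorm (v i) - a) ^+ 2.
  by apply: sumr_ge0 => i _; rewrite mulr_ge0 ?sqr_ge0.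
have -> : \sum_i mu i * (vnorm (v i) - a) ^+ 2 =
    \sum_i (mu i * vnorm (v i) ^+ 2 - 2 * a * (mu i * vnorm (v i))
            + a ^+ 2 * mu i).
  by apply: eq_bigr => i _; ring.
rewrite big_split sumrB /= -!mulr_sumr mu1 -/a.
set b := vnorm _ in le_a *; have b0 : 0 <= b := vnorm_ge0 _; set c := \sum_i _.
nra.
Qed.

(** * Roots of unity and unitarity of the QFT *)

Lemma expi_exp (t : R) k :
  (cos t +i* sin t) ^+ k = cos (k%:R * t) +i* sin (k%:R * t).
Proof.
elim: k => [|k IH]; first by rewrite expr0 mul0r cos0 sin0.
rewrite exprS IH -natr1 mulrDl mul1r addrC cosD sinD.
by simpc; congr (_ +i* _); ring.
Qed.

(** Half-angle formula: [cos t = 1 - 2 sin(t/2)^2], with [t/2] strictly between 0 and pi. *)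
Lemma cos_neq1 (t : R) : 0 < t < 2 * pi -> cos t != 1.
Proof.
move=> /andP[t0 t1].
have -> : t = (t / 2) *+ 2 by rewrite -mulr_natr divfK // pnatr_eq0.
rewrite cos_mulr2n cos2sin2.
have s0 : 0 < sin (t / 2) by apply: sin_gt0_pi; lra.
nra.
Qed.

Lemma expi_primitive_root N : (0 < N)%N ->
  N.-primitive_root (cos (2 * pi / N%:R) +i* sin (2 * pi / N%:R) : C).
Proof.
move=> N0; have N0' : (0 : R) < N%:R by rewrite ltr0n.
have p0 := pi_gt0 R.
rewrite /primitive_root_of_unity N0; apply/forallP => i.
rewrite unity_rootE expi_exp; apply/eqP.
have [->|ne] := eqVneq i.+1 N.
  have -> : N%:R * (2 * pi / N%:R) = pi *+ 2 :> R by field; rewrite gt_eqF.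
  by rewrite cos2pi sin2pi eqxx.
(* For exponents [i.+1 < N] the angle lies strictly between 0 and [2 pi], so the real part alone
   differs from 1. *)
rewrite eq_complex /=; apply/negbTE; rewrite negb_and cos_neq1 //.
have iN : (i.+1%:R : R) < N%:R by rewrite ltr_nat ltn_neqAle ne ltn_ord.
have i0 : (0 : R) < i.+1%:R by rewrite ltr0n.
rewrite mulrA; apply/andP; split; first by rewrite divr_gt0 // mulr_gt0 // mulr_gt0.
by rewrite ltr_pdivrMr // mulrC ltr_pM2l // mulr_gt0.
Qed.

Lemma norm_expi (t : R) : `|cos t +i* sin t| = 1 :> C.
Proof. by rewrite normc_def /= cos2Dsin2 sqrtr1. Qed.

(** Entry [(i, j)] is a normalized geometric sum with ratio [w = conj(z)^i z^j]: the ratio is 1 on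
    the diagonal and a nontrivial [N]-th root of unity off it. *)
Lemma qft1_unitary n : adjmx (qft1 R n) *m qft1 R n = 1%:M.
Proof.
set N := (2 ^ n)%N; have N0 : (0 < N)%N by rewrite expn_gt0.
set z : C := cos (2 * pi / N%:R) +i* sin (2 * pi / N%:R).
have prim_z : N.-primitive_root z := expi_primitive_root N0.
set c : C := (Num.sqrt N%:R)^-1%:C.
have qE i j : qft1 R n i j = c * z ^+ (i * j).
  rewrite mxE /z expi_exp /c; congr (_ * _).
  have -> : 2 * pi * (i * j)%:R / N%:R = (i * j)%:R * (2 * pi / N%:R) :> R by ring.
  by [].
have zz : z^*%R * z = 1 by rewrite mulrC -normCK norm_expi expr1n.
have cc : c^*%R * c * N%:R = 1.
  rewrite mulrC; have -> : c^*%R = c by exact: conjc_real.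
  have -> : (N%:R : C) = (N%:R : R)%:C by rewrite rmorph_nat.
  rewrite -!rmorphM /= -expr2 exprVn sqr_sqrtr ?ler0n // divff ?rmorph1 //.
  by rewrite pnatr_eq0 -lt0n.
apply/matrixP => i j; rewrite !mxE.
under eq_bigr => k _.
  rewrite adjmxE !qE rmorphM rmorphXn /= mulrACA ![(k * _)%N]mulnC !exprM -exprMn.
  over.
rewrite -mulr_sumr; set w := _ * _ ^+ j.
have [eij|nij] := eqVneq i j.
  have -> : w = 1 by rewrite /w eij -exprMn zz expr1n.
  under eq_bigr => k _ do rewrite expr1n.
  by rewrite sumr_const card_ord.
have wN : w ^+ N = 1.
  rewrite exprMn -!exprM ![(_ * N)%N]mulnC !exprM -rmorphXn.
  by rewrite (prim_expr_order prim_z) rmorph1 !expr1n mulr1.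
have w1 : w != 1.
  apply: contra_neq nij => w1; apply: ord_inj; apply/eqP.
  (* Multiply [z^i] by [w = 1] and cancel [z^i conj(z)^i]; exponents below [N] are then determined
     by the power of [z]. *)
  have : z ^+ i == z ^+ j.
    by rewrite -[_ ^+ i]mulr1 -w1 /w mulrA -exprMn [z * _]mulrC zz expr1n mul1r.
  by rewrite (eq_prim_root_expr prim_z) !modn_small.
have /eqP : (w - 1) * \sum_(k < N) w ^+ k = 0 by rewrite -subrX1 wN subrr.
by rewrite mulf_eq0 subr_eq0 (negbTE w1) => /eqP ->; rewrite mulr0.
Qed.

(** * The success operator is an orthogonal projection *)

Lemma ket_in_orthonormal n (x x' : 'I_(2 ^ n) * 'I_(2 ^ n)) :
  adjmx (ket_in R x) *m ket_in R x' = (x == x')%:R%:M.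
Proof.
have dd m (i j : 'I_m) :
    adjmx (delta_mx i (0 : 'I_1)) *m delta_mx j (0 : 'I_1) = (i == j)%:R%:M :> 'M[C]_1.
  rewrite /adjmx trmx_delta map_delta_mx mul_delta_mx_cond.
  by apply/matrixP=> a b; rewrite !ord1; case: (i == j); rewrite ?mulr0n !mxE.
rewrite /ket_in adjmx_tens_mul !dd !mxE !mulr1n -natrM mulnb.
by case: x x' => [a b] [c d]; rewrite xpair_eqE.
Qed.

Lemma success_op_adj n (Y : finType) (S : {set 'I_(2 ^ n) * 'I_(2 ^ n)}) :
  adjmx (success_op R Y S) = success_op R Y S.
Proof.
rewrite /success_op adjmx_tens adjmx1 !adjmxM adjmxK mulmxA.
by congr ((_ *m _ *m _) *t _); rewrite adjmx_sum;
   apply: eq_bigr => y _; rewrite adjmxM adjmxK.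
Qed.

Lemma success_op_idem n (Y : finType) (S : {set 'I_(2 ^ n) * 'I_(2 ^ n)}) :
  success_op R Y S *m success_op R Y S = success_op R Y S.
Proof.
have qU : adjmx (qft R n) *m qft R n = 1%:M.
  by rewrite /qft adjmx_tens tensmx_mul !qft1_unitary tensmx11.
rewrite /success_op tensmx_mul mulmx1; congr (_ *t _).
set D := \sum_(y in S) _; set U := qft R n in qU *.
(* Orthonormality of the basis kets leaves only the diagonal terms of the double sum. *)
have DD : D *m D = D.
  rewrite {1 3}/D mulmx_suml; apply: eq_bigr => y yS.
  rewrite /D mulmx_sumr (bigD1 y) //= big1 ?addr0.
    by rewrite mulmxA -(mulmxA _ _ (ket_in R y)) ket_in_orthonormal eqxx mulmx1.
  move=> y' /andP[_ ny].
  rewrite mulmxA -(mulmxA _ _ (ket_in R y')) ket_in_orthonormal eq_sym (negbTE ny).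
  by rewrite raddf0 mulmx0 mul0mx.
by rewrite !mulmxA -(mulmxA (U *m D)) qU mulmx1 -(mulmxA U D D) DD.
Qed.

(** * Decomposition into blocks indexed by the input register *)

Lemma vnorm_ket_out (Y : finType) (y : Y) : vnorm (ket_out R y) = 1.
Proof.
apply: (@pexpIrn _ 2) => //; rewrite ?nnegrE ?vnorm_ge0 // expr1n.
apply: (@complexI R); rewrite sqr_vnorm /ket_out /adjmx trmx_delta map_delta_mx.
by rewrite mul_delta_mx mxE !eqxx.
Qed.

Lemma sqr_vnorm_blocks n m (v : 'I_(2 ^ n) * 'I_(2 ^ n) -> 'cV[C]_m) :
  vnorm (\sum_x (ket_in R x *t v x)) ^+ 2 = \sum_x vnorm (v x) ^+ 2.
Proof.
apply: (@complexI R); rewrite sqr_vnorm rmorph_sum /= adjmx_sum mulmx_suml summxE.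
apply: eq_bigr => x _; rewrite mulmx_sumr (bigD1 x) //= big1 ?addr0.
  by rewrite adjmx_tens_mul ket_in_orthonormal eqxx sqr_vnorm !mxE mul1r.
move=> x' nx; rewrite adjmx_tens_mul ket_in_orthonormal eq_sym (negbTE nx).
by rewrite raddf0 [X in X * _]mxE mul0r raddf0.
Qed.

Lemma tens_cV_linear_sum m p (u : 'cV[C]_m) (I : finType) (a : I -> C)
    (v : I -> 'cV[C]_p) :
  (u *t (\sum_i a i *: v i) : 'cV_(m * p)) = \sum_i a i *: (u *t v i : 'cV_(m * p)).
Proof.
apply/matrixP=> i j; rewrite mxE !summxE mulr_sumr.
by apply: eq_bigr => k _; rewrite !mxE mulrCA.
Qed.

Lemma tens_cVB m p (u : 'cV[C]_m) (v w : 'cV[C]_p) :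
  (u *t (v - w) : 'cV_(m * p)) = (u *t v : 'cV_(m * p)) - u *t w.
Proof. by apply/matrixP=> i j; rewrite !mxE mulrBr. Qed.

Lemma tens_cVZ m p (a : C) (u : 'cV[C]_m) (v : 'cV[C]_p) :
  (u *t (a *: v) : 'cV_(m * p)) = a *: (u *t v : 'cV_(m * p)).
Proof. by apply/matrixP=> i j; rewrite !mxE mulrCA. Qed.

(** * Error of the state averaged over the masks *)

Section MaskedOracle.

Variables (n : nat) (Y Omega : finType) (mu : Omega -> R).
Local Notation X := ('I_(2 ^ n) * 'I_(2 ^ n))%type.
Variables (f : X -> Y) (f' : Omega -> X -> Y) (s : Omega -> X -> int).
Hypotheses (mu_ge0 : forall w, 0 <= mu w) (mu_sum1 : \sum_w mu w = 1).
Hypothesis s_pm1 : forall w x, s w x = -1 \/ s w x = 1.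

(** On the bad set the error is a difference of unit vectors; off it the outputs agree and the sign
    is 1, so the error vanishes. *)
Lemma vnorm_block_error w x :
  vnorm (ket_out R (f x) - (s w x)%:~R *: ket_out R (f' w x))
    <= if x \in bad_set (s w) f (f' w) then 2 else 0.
Proof.
rewrite inE; case: ifP => [_|/negbT].
  apply: le_trans (vnormD _ _) _.
  have -> : - ((s w x)%:~R *: ket_out R (f' w x)) =
      (- (s w x)%:~R : R)%:C *: ket_out R (f' w x).
    by rewrite rmorphN rmorph_int scaleNr.
  by rewrite vnormZ !vnorm_ket_out normrN mulr1; case: (s_pm1 w x) => ->;
     rewrite ?rmorphN1 ?normrN normr1.
rewrite negb_or negbK => /andP[/eqP -> ns].
case: (s_pm1 w x) ns => -> // _.
by rewrite scale1r subrr vnorm0.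
Qed.

Lemma vnorm_mean_error (pf : R) :
  (forall x, \sum_(w | x \in bad_set (s w) f (f' w)) mu w <= pf) ->
  vnorm (oracle_state R f - \sum_w (mu w)%:C *: signed_oracle_state R (s w) (f' w))
    <= 2 * pf.
Proof.
move=> Bpf.
have pf0 : 0 <= pf.
  have x0 : 'I_(2 ^ n) by apply: (@Ordinal _ 0); rewrite expn_gt0.
  by apply: le_trans (Bpf (x0, x0)); apply: sumr_ge0.
(* The mean error in block [x], without the normalization [N^(-1/2)]. *)
pose v x := \sum_w (mu w)%:C *: (ket_out R (f x) - (s w x)%:~R *: ket_out R (f' w x)).
have v_le x : vnorm (v x) <= 2 * pf.
  apply: le_trans (vnorm_sum _ _) _; apply: le_trans (ler_wpM2l _ (Bpf x)) => //.
  rewrite mulr_sumr [leRHS]big_mkcond /=; apply: ler_sum => w _.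
  rewrite vnormZ ger0_norm //; have := vnorm_block_error w x.
  by case: ifP => _ h; [rewrite mulrC ler_wpM2r | rewrite mulr_ge0_le0].
have -> : oracle_state R f - \sum_w (mu w)%:C *: signed_oracle_state R (s w) (f' w) =
    (Num.sqrt (#|{: X}|%:R : R))^-1%:C *: \sum_x (ket_in R x *t v x).
  rewrite /oracle_state /signed_oracle_state; set c := _%:C.
  have -> : \sum_w (mu w)%:C *: (c *: \sum_x (s w x)%:~R *: ket R x (f' w x)) =
      c *: \sum_x \sum_w (mu w)%:C *: ((s w x)%:~R *: ket R x (f' w x)).
    rewrite exchange_big scaler_sumr /=; apply: eq_bigr => w _.
    by rewrite scalerA mulrC -scalerA scaler_sumr.
  rewrite -scalerBr -sumrB; congr (_ *: _); apply: eq_bigr => x _.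
  rewrite tens_cV_linear_sum.
  under [RHS]eq_bigr => w _ do rewrite tens_cVB tens_cVZ scalerBr.
  (* The ideal ket does not depend on [w], and the weights sum to 1. *)
  by rewrite sumrB -scaler_suml -rmorph_sum mu_sum1 scale1r.
rewrite -(@ler_pXn2r _ 2) ?nnegrE ?vnorm_ge0 ?mulr_ge0 // vnormZ exprMn.
rewrite sqr_vnorm_blocks real_normK ?num_real // exprVn sqr_sqrtr ?ler0n //.
have X0 : (0 : R) < #|{: X}|%:R by rewrite ltr0n card_prod card_ord muln_gt0 expn_gt0.
(* The prefactor [1/N] cancels the number of blocks, each contributing at most [(2 pf)^2]. *)
rewrite mulrC ler_pdivrMr // mulr_natr -sumr_const; apply: ler_sum => x _.
by rewrite ler_pXn2r ?nnegrE ?vnorm_ge0 ?mulr_ge0.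
Qed.

End MaskedOracle.
End MaskedShor.

(** * Combining the projection, error and convexity bounds *)

Theorem mainTheorem1
  (R : realType)
  (n : nat) (n_ge1 : (1 <= n)%N)
  (p : nat) (p_prime : prime p)
  (E : elliptic_curve 'F_p) (P Q : ec_point E)
  (Y : finType) (emb : ec_point E -> Y) (emb_inj : injective emb)
  (Omega : finType) (mu : Omega -> R)
  (mu_ge0 : forall w, 0 <= mu w) (mu_sum1 : \sum_w mu w = 1)
  (f' : Omega -> 'I_(2 ^ n) * 'I_(2 ^ n) -> Y)
  (s : Omega -> 'I_(2 ^ n) * 'I_(2 ^ n) -> int)
  (s_pm1 : forall w x, s w x = -1 \/ s w x = 1)
  (S : {set 'I_(2 ^ n) * 'I_(2 ^ n)})
  (pf P0 : R) :
  let f := fun x => emb (double_mul P Q x) in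
  let B := fun w => bad_set (s w) f (f' w) in
  let Psi := oracle_state R f in
  let Psi' := fun w => signed_oracle_state R (s w) (f' w) in
  let M := success_op R Y S in
  let Pid := bracket Psi M Psi in
  let P' := \sum_w (mu w)%:C * bracket (Psi' w) M (Psi' w) in
  0 <= pf ->
  (forall x, \sum_(w | x \in B w) mu w <= pf) ->
  0 <= P0 ->
  P0%:C <= Pid ->
  ((Num.max 0 (Num.sqrt P0 - 2 * pf)) ^+ 2)%:C <= P'.
Proof.
move=> f B Psi Psi' M Pid P' pf0 Bpf P00 P0_le.
have hM : adjmx M = M := success_op_adj R Y S.
have pM : M *m M = M := success_op_idem R Y S.
rewrite /P'; under eq_bigr => w _ do rewrite bracket_proj // -rmorphM.
rewrite -rmorph_sum [X in X <= _]/= lecR.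
move: P0_le; rewrite /Pid bracket_proj // lecR => P0_le.
set m := \sum_w (mu w)%:C *: Psi' w.
have le_m : Num.sqrt P0 - 2 * pf <= vnorm (M *m m).
  rewrite lerBlDr; apply: (@le_trans _ _ (vnorm (M *m Psi))).
    by rewrite -(ger0_norm (vnorm_ge0 (M *m Psi))) -sqrtr_sqr ler_sqrt ?sqr_ge0.
  (* Split [Psi = m + (Psi - m)]; the projection does not enlarge the second term. *)
  rewrite -[Psi in X in X <= _](subrK m) addrC mulmxDr.
  apply: le_trans (vnormD _ _) _; rewrite lerD2l.
  exact: le_trans (vnorm_proj _ hM pM) (vnorm_mean_error mu_ge0 mu_sum1 s_pm1 Bpf).
apply: (@le_trans _ _ (vnorm (M *m m) ^+ 2)).
  (* Truncation at 0 makes both sides nonnegative, so squaring preserves the inequality. *)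
  by rewrite ler_pXn2r ?nnegrE ?vnorm_ge0 ?le_max ?lexx // ge_max vnorm_ge0.
(* By linearity [M m] is the mean of the vectors [M (Psi' w)], to which Jensen applies. *)
rewrite /m mulmx_sumr; under eq_bigr => w _ do rewrite -scalemxAr.
exact: vnorm_jensen.
Qed.
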